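(* Let $\mathbb G=(\mathbb V,\mathbb E)$ be a countably infinite, locally finite, connected graph with edge weights $\mathbf c_e\ge1$. For $x\in\mathbb V$ and finite connected subgraphs $D\subset D'$ of $\mathbb G$ containing $x$, one has $\mathbb E^{\pm1}_D[h(x)^2]\le\mathbb E^{\pm1}_{D'}[h(x)^2]$. Consequently, as $D\uparrow\mathbb G$, either $\mathbb E^{\pm1}_D[h(x)^2]$ increases to a finite limit (Var-loc) or it increases to $+\infty$ (Var-deloc); moreover the same alternative occurs for all $x\in\mathbb V$.
   Context: $\mathbb Z_{\rm odd}=2\mathbb Z+1$. For a finite connected subgraph $D=(V,E)$ of $\mathbb G$, a height function is $h:V\to\mathbb Z_{\rm odd}$ with $|h(v)-h(w)|\le2$ along edges of $D$, weight $W(h)=\prod_{e=\langle v,w\rangle\in E}\mathbf c_e^{\mathbb 1\{h(v)=h(w)\}}$; $\partial D$ is the set of vertices of $D$ incident to an edge of $\mathbb E\setminus E$; $\mathbb P^{\pm1}_D$ is the probability measure on height functions on $D$ with $h(x)\in\{-1,1\}$ for $x\in\partial D$ and probabilities proportional to $W(h)$. *)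

(* Defs.v *)
From HB Require Import structures.
From mathcomp Require Import all_boot all_order all_algebra.
From mathcomp Require Import all_classical all_reals all_analysis.
Set Implicit Arguments. Unset Strict Implicit. Unset Printing Implicit Defensive.
Import Order.TTheory GRing.Theory Num.Theory.
Local Open Scope ring_scope.
Local Open Scope classical_set_scope.

(* A finite subgraph D = (fsv D, fse D) of the ambient graph: a finite list of
   vertices and an edge relation (unordered edges represented symmetrically). *)
Record fsubgraph (V : countType) := FSub { fsv : seq V; fse : rel V }.

Section HeightDefs.
Variables (V : countType) (adj : rel V).

Definition is_fin_conn_subgraph (D : fsubgraph V) : Prop :=
  [/\ (forall u v, fse D u v -> fse D v u),
      (forall u v, fse D u v -> [/\ adj u v, u \in fsv D & v \in fsv D]) &
      (forall u v, u \in fsv D -> v \in fsv D ->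
         exists p : seq V, path (fse D) u p /\ last u p = v)].

Definition subgraph_of (D D' : fsubgraph V) : Prop :=
  {subset fsv D <= fsv D'} /\ (forall u v, fse D u v -> fse D' u v).

Definition bdry (D : fsubgraph V) (v : V) : Prop :=
  v \in fsv D /\ exists w, adj v w /\ ~~ fse D v w.

(* height functions on D with boundary values in {-1,1}; a height function on
   V_D is encoded as a function V -> int vanishing outside V_D *)
Definition heights (D : fsubgraph V) : set (V -> int) :=
  [set h | [/\ (forall v, v \notin fsv D -> h v = 0),
              (forall v, v \in fsv D -> exists k : int, h v = 2 * k + 1),
              (forall u v, fse D u v -> `|h u - h v| <= 2) &
              (forall v, bdry D v -> h v = 1 \/ h v = -1)]].

Variable R : realType.
Variable c : V -> V -> R.

(* W(h) = prod over (unordered) edges e of D of c_e^{1{h(v)=h(w)}}; each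
   unordered edge {u,v} is counted once, via the orientation pickle u < pickle v *)
Definition weight (D : fsubgraph V) (h : V -> int) : R :=
  \prod_(u <- undup (fsv D))
    \prod_(v <- undup (fsv D) | fse D u v && (pickle u < pickle v)%N)
      (if h u == h v then c u v else 1).

Definition Esq (D : fsubgraph V) (x : V) : R :=
  fine (\esum_(h in heights D) ((h x)%:~R ^+ 2 * weight D h)%:E)
  / fine (\esum_(h in heights D) (weight D h)%:E).

End HeightDefs.

(* Main.v *)
Require Import Defs.
From HB Require Import structures.
From mathcomp Require Import all_boot all_order all_algebra.
From mathcomp Require Import all_classical all_reals all_analysis.
From mathcomp Require Import ring lra zify.
Set Implicit Arguments. Unset Strict Implicit. Unset Printing Implicit Defensive.
Import Order.TTheory GRing.Theory Num.Theory numFieldNormedType.Exports.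
Local Open Scope ring_scope.
Local Open Scope classical_set_scope.

(* Write h = s (2 m + 1) with a sign s and m >= 0. Given m, the signs form a ferromagnetic
   Ising model with couplings (log c_e) / 2, conditioned to agree along every edge that meets
   {m > 0}; the remaining factor is a nearest-neighbour interaction of m which is
   log-concave because c_e >= 1. Griffiths' second inequality for the Ising factor and
   log-concavity for the other one give Holley's condition
     w_D(m) w_D'(n) <= w_D'(max(m,n)) w_D(min(m,n))
   between the laws of m for D and D' (for D, put m = 0 on the boundary of D and off D), so
   the four functions theorem yields E_D[h(x)^2] <= E_D'[h(x)^2].
   Since h is 2-Lipschitz along edges, E_D[h(y)^2] <= 2 E_D[h(x)^2] + 8 d^2 once D contains
   a path of length d from x to y; hence boundedness in D does not depend on the vertex. *)

(** * Griffiths' second inequality *)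

Section Griffiths.
Variables (R : realFieldType) (T : finType).
Local Notation spins := {ffun T -> bool}.
Implicit Types (F G w : spins -> R) (s t : spins) (l : seq T).

(** A monomial in the spins (-1)^(s i). Repetitions in [l] are allowed, so that a product of
    monomials is the monomial of the concatenated list. *)
Definition mono l s : R := \prod_(i <- l) (-1) ^+ s i.

Definition flips (t s : spins) : spins := [ffun i => s i (+) t i].

Lemma flipsK t : involutive (flips t).
Proof. by move=> s; apply/ffunP=> i; rewrite !ffunE addbK. Qed.

Lemma mono_cat l1 l2 s : mono (l1 ++ l2) s = mono l1 s * mono l2 s.
Proof. by rewrite /mono big_cat. Qed.

Lemma mono_flips l t s : mono l (flips t s) = mono l t * mono l s.
Proof.
rewrite /mono -big_split; apply: eq_bigr => i _ /=.
by rewrite ffunE signr_addb mulrC.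
Qed.

Lemma mono_le1 l s : mono l s <= 1.
Proof.
have : `|mono l s| = 1.
  rewrite /mono normr_prod big1 // => i _; exact: normr_sign.
by move=> <-; exact: ler_norm.
Qed.

Lemma mono_geN1 l s : -1 <= mono l s.
Proof.
have <- : `|mono l s| = 1.
  rewrite /mono normr_prod big1 // => i _; exact: normr_sign.
by rewrite lerNl -normrN; exact: ler_norm.
Qed.

(** The sum factorises over the sites. A site occurring k times in [l] contributes 1 + (-1)^k, which
    is 0 or 2. *)
Lemma sum_mono_ge0 l : 0 <= \sum_s mono l s.
Proof.
have E s : mono l s = \prod_i ((-1) ^+ s i) ^+ count_mem i l.
  rewrite /mono; elim: l => [|j l IH].
    by rewrite big_nil big1 // => i _; rewrite expr0.
  rewrite big_cons IH /= (bigD1 j) //= [in RHS](bigD1 j) //= eqxx mulrA exprD expr1.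
  congr (_ * _); apply: eq_bigr => i /negPf ij.
  by rewrite eq_sym ij add0n.
under eq_bigr do rewrite E.
rewrite -(bigA_distr_bigA (fun i (b : bool) => ((-1) ^+ b : R) ^+ count_mem i l)).
apply: prodr_ge0 => i _; rewrite big_bool /= expr1 expr1n.
by rewrite -signr_odd; case: odd; rewrite ?expr1 ?expr0; lra.
Qed.

(** Polynomials in the spins with nonnegative coefficients. The constructors use pointwise equality,
    so membership depends only on the values. *)
Inductive cone : (spins -> R) -> Prop :=
| cone0 F : F =1 (fun=> 0) -> cone F
| coneD F G (a : R) l : 0 <= a -> cone G ->
    F =1 (fun s => a * mono l s + G s) -> cone F.

Lemma cone_ext F G : F =1 G -> cone F -> cone G.
Proof.
move=> FG CF; case: CF FG => [F' F0|F' G' a l a0 CG F0] FG.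
  by apply: cone0 => s; rewrite -FG F0.
by apply: (coneD (a := a) (l := l) a0 CG) => s; rewrite -FG F0.
Qed.

Lemma cone_mono (a : R) l : 0 <= a -> cone (fun s => a * mono l s).
Proof.
by move=> a0; apply: (coneD a0 (@cone0 (fun=> 0) _)) => // s; rewrite addr0.
Qed.

Lemma cone_const (a : R) : 0 <= a -> cone (fun=> a).
Proof.
move=> a0; apply: cone_ext (cone_mono [::] a0) => s.
by rewrite /mono big_nil mulr1.
Qed.

Lemma cone_add F G : cone F -> cone G -> cone (fun s => F s + G s).
Proof.
move=> CF CG; elim: CF => {F} [F F0|F H a l a0 CH IH FE].
  by apply: cone_ext CG => s; rewrite F0 add0r.
by apply: (coneD a0 IH) => s; rewrite FE addrA.
Qed.

Lemma cone_mul F G : cone F -> cone G -> cone (fun s => F s * G s).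
Proof.
move=> CF CG; elim: CF => {F} [F F0|F H a l a0 CH IH FE].
  by apply: cone0 => s; rewrite F0 mul0r.
have : cone (fun s => a * mono l s * G s).
  elim: CG => {G IH} [G G0|G G' b k b0 CG IH GE].
    by apply: cone0 => s; rewrite G0 mulr0.
  apply: (coneD (mulr_ge0 a0 b0) (l := l ++ k) IH) => s.
  by rewrite GE mono_cat; ring.
move=> C; apply: cone_ext (cone_add C IH) => s.
by rewrite FE; ring.
Qed.

Lemma cone_prod (I : finType) (P : pred I) (F : I -> spins -> R) :
  (forall i, P i -> cone (F i)) -> cone (fun s => \prod_(i | P i) F i s).
Proof.
move=> CF; elim: (index_enum I) => [|i r IH].
  by apply: cone_ext (cone_const ler01) => s; rewrite big_nil.
case Pi: (P i); last by apply: cone_ext IH => s; rewrite big_cons Pi.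
by apply: cone_ext (cone_mul (CF i Pi) IH) => s; rewrite big_cons Pi.
Qed.

Lemma cone_sum_ge0 F : cone F -> 0 <= \sum_s F s.
Proof.
elim=> {F} [F F0|F G a l a0 _ IH FE].
  by rewrite big1 // => s _; rewrite F0.
under eq_bigr do rewrite FE.
rewrite big_split /= -mulr_sumr addr_ge0 // mulr_ge0 //; exact: sum_mono_ge0.
Qed.

(** A flip by [t] multiplies each monomial by [mono l t], which is at most 1, so a coefficient [a]
    becomes [a * (1 - mono l t)] and stays nonnegative. *)
Lemma cone_diff F t : cone F -> cone (fun s => F s - F (flips t s)).
Proof.
elim=> {F} [F F0|F G a l a0 _ IH FE].
  by apply: cone0 => s; rewrite !F0 subr0.
have b0 : 0 <= a * (1 - mono l t).
  by rewrite mulr_ge0 // subr_ge0 mono_le1.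
apply: (coneD b0 (l := l) IH) => s.
by rewrite !FE mono_flips; ring.
Qed.

(** The condition on a weight for Ginibre's duplication: with the relative configuration [t] of the
    two copies fixed, the product weight is a positive polynomial in [s]. *)
Definition dup_cone w := forall t, cone (fun s => w s * w (flips t s)).

Lemma dup_cone_mul w1 w2 :
  dup_cone w1 -> dup_cone w2 -> dup_cone (fun s => w1 s * w2 s).
Proof.
move=> C1 C2 t; apply: cone_ext (cone_mul (C1 t) (C2 t)) => s; ring.
Qed.

Lemma dup_cone_prod (I : finType) (P : pred I) (F : I -> spins -> R) :
  (forall i, P i -> dup_cone (F i)) -> dup_cone (fun s => \prod_(i | P i) F i s).
Proof.
move=> CF t; apply: cone_ext (cone_prod (fun i Pi => CF i Pi t)) => s.
by rewrite big_split.
Qed.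

(** Write X = [mono l s] and e = [mono l t]. As X^2 = 1, the product (a + b X)(a + b e X) equals a^2
    + b^2 e + a b (1 + e) X, and both coefficients are nonnegative because e >= -1 and b <= a. *)
Lemma dup_cone_affine (a b : R) l : 0 <= b -> b <= a ->
  dup_cone (fun s => a + b * mono l s).
Proof.
move=> b0 ba t.
have h1 := mono_geN1 l t.
have a0 : 0 <= a by lra.
have C1 : 0 <= a * a + b * b * mono l t.
  have h2 : b * b <= a * a by rewrite ler_pM.
  have h3 : 0 <= b * b by rewrite mulr_ge0.
  nra.
have C2 : 0 <= a * b * (1 + mono l t) by rewrite !mulr_ge0 //; lra.
apply: cone_ext (cone_add (cone_const C1) (cone_mono l C2)) => s.
rewrite mono_flips.
have sq : mono l s * mono l s = 1.
  rewrite /mono -big_split /= big1 // => i _; rewrite -expr2 sqrr_sign //.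
transitivity (a * a + b * b * mono l t * (mono l s * mono l s) + a * b * (1 + mono l t) * mono l s); last by ring.
by rewrite sq; ring.
Qed.

(* Ginibre's duplication: with [s' = flips t s] the double sum of
   [w s w s' (f s - f s') (g s - g s')] is, for fixed [t], the sum of an element of the cone. *)
Lemma griffiths w f g : dup_cone w -> cone f -> cone g ->
  (\sum_s w s * f s) * (\sum_s w s * g s) <=
  (\sum_s w s) * (\sum_s w s * (f s * g s)).
Proof.
move=> Cw Cf Cg.
have dsum (A B : spins -> R) :
    (\sum_s A s) * (\sum_s B s) = \sum_t \sum_s A s * B (flips t s).
  rewrite mulr_suml exchange_big /=; apply: eq_bigr => s _.
  rewrite mulr_sumr (reindex_inj (h := fun t => flips s t)); last exact: inv_inj (flipsK _).
  apply: eq_bigr => t _; congr (_ * B _).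
  by apply/ffunP=> i; rewrite !ffunE addbC.
have E : 2 * ((\sum_s w s) * (\sum_s w s * (f s * g s))
              - (\sum_s w s * f s) * (\sum_s w s * g s)) =
   \sum_t \sum_s (w s * w (flips t s)) * ((f s - f (flips t s)) * (g s - g (flips t s))).
  transitivity ((\sum_s w s) * (\sum_s w s * (f s * g s)) + (\sum_s w s * (f s * g s)) * (\sum_s w s)
     - ((\sum_s w s * f s) * (\sum_s w s * g s) + (\sum_s w s * g s) * (\sum_s w s * f s))).
    ring.
  rewrite !dsum -!big_split -sumrB /=; apply: eq_bigr => t _.
  rewrite -!big_split -sumrB /=; apply: eq_bigr => s _; ring.
rewrite -subr_ge0 -(pmulr_rge0 _ (ltr0n R 2)) E.
apply: sumr_ge0 => t _; apply: cone_sum_ge0.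
by apply: cone_mul => //; apply: cone_mul; exact: cone_diff.
Qed.

Lemma ising_edge (a b : R) (u v : T) s :
  (if s u == s v then a else b) = (a + b) / 2 + (a - b) / 2 * mono [:: u; v] s.
Proof.
rewrite /mono !big_cons big_nil mulr1.
by case: (s u); case: (s v); rewrite /= ?expr1 ?expr0; field.
Qed.

(** Applied below with (a, b) = (c_e, 1) for an Ising factor, where c_e >= 1 is what makes it
    ferromagnetic, and with (1, 0) for the constraint that two spins agree. *)
Lemma cone_edge (a b : R) (u v : T) : 0 <= b -> b <= a ->
  cone (fun s => if s u == s v then a else b).
Proof.
move=> b0 ba.
have C1 : 0 <= (a + b) / 2 by lra.
have C2 : 0 <= (a - b) / 2 by lra.
apply: cone_ext (cone_add (cone_const C1) (cone_mono [:: u; v] C2)) => s.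
by rewrite -ising_edge.
Qed.

Lemma dup_cone_edge (a b : R) (u v : T) : 0 <= b -> b <= a ->
  dup_cone (fun s => if s u == s v then a else b).
Proof.
move=> b0 ba t.
have C1 : 0 <= (a - b) / 2 by lra.
have C2 : (a - b) / 2 <= (a + b) / 2 by lra.
apply: cone_ext (dup_cone_affine [:: u; v] C1 C2 t) => s.
by rewrite -!ising_edge.
Qed.

End Griffiths.

(** * The four functions theorem *)

Section FourFunctions.
Variables (R : realFieldType) (T : finType) (K : nat).
Local Notation conf := {ffun T -> 'I_K}.

Definition omin (a b : 'I_K) := if (a <= b)%N then a else b.
Definition omax (a b : 'I_K) := if (a <= b)%N then b else a.
Definition cmin (m n : conf) : conf := [ffun v => omin (m v) (n v)].
Definition cmax (m n : conf) : conf := [ffun v => omax (m v) (n v)].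

(** The double sums are symmetrised in (a, b), which leaves one inequality x + y <= P + Q for each
    pair a <= b. *)
Lemma four_functions_chain (f1 f2 f3 f4 : 'I_K -> R) :
  (forall a, 0 <= f1 a) -> (forall a, 0 <= f2 a) ->
  (forall a, 0 <= f3 a) -> (forall a, 0 <= f4 a) ->
  (forall a b, f1 a * f2 b <= f3 (omax a b) * f4 (omin a b)) ->
  (\sum_a f1 a) * (\sum_a f2 a) <= (\sum_a f3 a) * (\sum_a f4 a).
Proof.
move=> p1 p2 p3 p4 H.
have dbl (f g : 'I_K -> R) : 2 * ((\sum_a f a) * (\sum_a g a)) =
    \sum_a \sum_b (f a * g b + f b * g a).
  have E : (\sum_a f a) * (\sum_a g a) = \sum_a \sum_b f a * g b.
    by rewrite mulr_suml; apply: eq_bigr => a _; rewrite mulr_sumr.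
  rewrite mulr_natl mulr2n {1}E E [X in _ + X]exchange_big -big_split /=.
  by apply: eq_bigr => a _; rewrite -big_split.
rewrite -(ler_pM2l (ltr0n R 2)) !dbl.
apply: ler_sum => a _; apply: ler_sum => b _.
wlog ab : a b / (a <= b)%N.
  move=> W; case: (leqP a b) => [/W//|/ltnW /W].
  by rewrite addrC [X in _ <= X]addrC.
have /= h1 := H a b; have /= h2 := H b a; have /= h3 := H a a; have /= h4 := H b b.
move: h1 h2 h3 h4; rewrite /omax /omin ab !leqnn.
have -> : (if (b <= a)%N then a else b) = b.
  by case: leqP => // ba; apply/val_inj/eqP; rewrite eqn_leq ab ba.
have -> : (if (b <= a)%N then b else a) = a.
  by case: leqP => // ba; apply/val_inj/eqP; rewrite eqn_leq ab ba.
set x := f1 a * f2 b; set y := f1 b * f2 a; set P := f3 b * f4 a => h1 h2 h3 h4.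
set Q := f3 a * f4 b.
(* Both x and y are at most P, and x y <= P Q. Hence 0 <= (P - x)(P - y) gives P (x + y) <= P^2 + x
   y <= P (P + Q), and P can be cancelled unless it is 0. *)
have h5 : x * y <= P * Q.
  have -> : x * y = (f1 a * f2 a) * (f1 b * f2 b) by rewrite /x /y; ring.
  have -> : P * Q = (f3 a * f4 a) * (f3 b * f4 b) by rewrite /P /Q; ring.
  by apply: ler_pM => //; rewrite mulr_ge0.
have Q0 : 0 <= Q by rewrite mulr_ge0.
have P0 : 0 <= P by rewrite mulr_ge0.
case: (ltrgtP P 0) P0 => // [P0 _|P0 _]; last by rewrite P0 in h1 h2 *; lra.
rewrite [Q + P]addrC -(ler_pM2l P0).
have : 0 <= (P - x) * (P - y) by rewrite mulr_ge0 // subr_ge0.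
nra.
Qed.

Definition upd (m : conf) (v : T) (a : 'I_K) : conf :=
  [ffun w => if w == v then a else m w].

Definition sum_at (v : T) (f : conf -> R) (m : conf) := \sum_a f (upd m v a).

(** With [s] the list of all sites this writes the total sum as iterated one-site sums, which allows
    an induction over the sites. *)
Lemma foldr_sum_at (f : conf -> R) (s : seq T) m : uniq s ->
  foldr sum_at f s m = \sum_(n : conf | [forall v, (v \notin s) ==> (n v == m v)]) f n.
Proof.
elim: s m => [|v s IH] m.
  move=> _ /=; rewrite (big_pred1 m) // => n /=.
  apply/forallP/eqP => [H|-> v]; last by rewrite eqxx.
  by apply/ffunP => v; have /= /eqP := H v.
move=> /= /andP[vs us]; rewrite /sum_at.
rewrite [RHS](partition_big (fun n : conf => n v) xpredT) //=.
apply: eq_bigr => a _; rewrite IH //; apply: eq_bigl => n.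
apply/forallP/andP => [H|[/forallP H /eqP nv] w].
  split; last by have /implyP/(_ vs) := H v; rewrite ffunE eqxx.
  apply/forallP => w; rewrite inE negb_or; apply/implyP => /andP[wv ws].
  by have /implyP/(_ ws) := H w; rewrite ffunE (negPf wv).
rewrite ffunE; apply/implyP => ws; have [->|wv] := eqVneq w v; first by rewrite nv.
by have := H w; rewrite inE negb_or wv ws.
Qed.

Lemma four_functions (f1 f2 f3 f4 : conf -> R) :
  (forall m, 0 <= f1 m) -> (forall m, 0 <= f2 m) ->
  (forall m, 0 <= f3 m) -> (forall m, 0 <= f4 m) ->
  (forall m n, f1 m * f2 n <= f3 (cmax m n) * f4 (cmin m n)) ->
  (\sum_m f1 m) * (\sum_m f2 m) <= (\sum_m f3 m) * (\sum_m f4 m).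
Proof.
move=> p1 p2 p3 p4 H.
(* There is no configuration at all when [K] is 0 and [T] is nonempty; all sums are then empty. *)
case: (pickP (fun _ : conf => true)) => [m0 _|no]; last first.
  by rewrite !big_pred0 //; lra.
have tot f : \sum_m f m = foldr sum_at f (enum T) m0.
  rewrite foldr_sum_at ?enum_uniq //; apply: eq_bigl => n.
  by symmetry; apply/forallP => v; rewrite mem_enum.
rewrite !tot.
have p s f : (forall m, 0 <= f m) -> forall m, 0 <= foldr sum_at f s m.
  by move=> f0; elim: s => //= v s IH m; apply: sumr_ge0.
have cmaxx m : cmax m m = m.
  by apply/ffunP => v; rewrite ffunE /omax leqnn.
have cminn m : cmin m m = m.
  by apply/ffunP => v; rewrite ffunE /omin leqnn.
(* Strengthened for the induction: summing out the sites of [s] preserves the lattice condition. One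
   more site is handled by the totally ordered case. *)
suff W s m n : foldr sum_at f1 s m * foldr sum_at f2 s n <=
    foldr sum_at f3 s (cmax m n) * foldr sum_at f4 s (cmin m n).
  by have := W (enum T) m0 m0; rewrite cmaxx cminn.
elim: s m n => //= v s IH m n.
apply: four_functions_chain => [a|a|a|a|a b]; try exact: p.
apply: le_trans (IH _ _) _.
have -> : cmax (upd m v a) (upd n v b) = upd (cmax m n) v (omax a b).
  by apply/ffunP => w; rewrite !ffunE; case: eqP.
have -> // : cmin (upd m v a) (upd n v b) = upd (cmin m n) v (omin a b).
by apply/ffunP => w; rewrite !ffunE; case: eqP.
Qed.

End FourFunctions.

(** * Comparison of two finite height models *)

Section FiniteModel.
Variables (R : realFieldType) (T : finType) (K : nat) (c : T -> T -> R).
Local Notation conf := {ffun T -> 'I_K}.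
Local Notation spins := {ffun T -> bool}.
Implicit Types (m n : conf) (s : spins).

Definition height m s v : int := (-1) ^+ s v * (m v).*2.+1%:Z.

(** The constraint on gradients is put into the weight as a factor 0, so that sums may run over all
    pairs of a magnitude and a spin configuration. *)
Definition hedge (a : R) (x y : int) : R :=
  if `|x - y| <= 2 then (if x == y then a else 1) else 0.

(* The weight of an edge splits into a log-concave gradient interaction of [m], an
   Ising interaction, and the constraint that spins agree unless both heights are +-1. *)
Definition grad (a : R) (i j : nat) : R :=
  if i == j then 1 else if (i <= j.+1)%N && (j <= i.+1)%N then a^-1 else 0.

Definition frozen m (e : T * T) := (0 < m e.1)%N || (0 < m e.2)%N.

Definition agree (e : T * T) s : R := if s e.1 == s e.2 then 1 else 0.

Definition ising (e : T * T) s : R := if s e.1 == s e.2 then c e.1 e.2 else 1.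

(** If an end has positive [m], opposite signs make the heights differ by at least 4, so the spins
    must agree; [ising] then gives c_e even for unequal heights, and the [a^-1] in [grad] cancels
    it. If both ends have [m] = 0, the heights are equal exactly when the spins agree. *)
Lemma hedge_factor m s (e : T * T) : 0 < c e.1 e.2 ->
  hedge (c e.1 e.2) (height m s e.1) (height m s e.2) =
  grad (c e.1 e.2) (m e.1) (m e.2) * ising e s * (if frozen m e then agree e s else 1).
Proof.
case: e => u v /= c0; rewrite /hedge /height /grad /ising /agree /frozen /=.
move: (nat_of_ord (m u)) (nat_of_ord (m v)) => i j.
have cn0 : c u v != 0 by lra.
have -> : (i.*2.+1)%:Z = 2 * i%:Z + 1 by lia.
have -> : (j.*2.+1)%:Z = 2 * j%:Z + 1 by lia.
case: (s u); case: (s v) => /=; rewrite ?expr1 ?expr0.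
all: repeat case: ifP => ?.
all: try (exfalso; lia).
all: by rewrite ?mulr1 ?mul1r ?mulr0 ?mul0r // mulVf.
Qed.

Lemma grad_ge0 (a : R) i j : 0 <= a -> 0 <= grad a i j.
Proof. by move=> a0; rewrite /grad; do !case: ifP => _; rewrite ?ler01 ?invr_ge0. Qed.

(** Only pairs ordered in opposite directions matter. There the two gradients on the right have the
    same sum as those on the left and lie between them, so the claim is log-concavity of the
    sequence 1, 1/a, 0 in the absolute gradient, which holds as a >= 1. *)
Lemma grad_lattice (a : R) (i j i' j' : 'I_K) : 1 <= a ->
  grad a i j * grad a i' j' <=
  grad a (omax i i') (omax j j') * grad a (omin i i') (omin j j').
Proof.
move=> a1; have a0 : 0 <= a by lra.
have b0 : 0 <= a^-1 by rewrite invr_ge0.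
have b1 : a^-1 <= 1 by rewrite invf_le1 //; lra.
rewrite /omax /omin.
case: (leqP i i') => hi; case: (leqP j j') => hj; rewrite ?lexx //.
all: try by rewrite mulrC.
all: rewrite /grad; do !case: eqP => ?; do ?case: ifP => ?.
all: rewrite ?mulr1 ?mul1r ?mul0r ?mulr0 ?lexx ?mulr_ge0 ?mulr_ile1 //.
all: try (exfalso; lia).
all: try by apply: le_trans (mulr_ile1 _ _ _ _) _.
Qed.

(** [E] and [E'] are the edges of D and D'; [S] and [S'] are the sites where [m] is forced to
    vanish, including for [S] the sites outside D. *)
Variables (E E' : pred (T * T)) (S S' : pred T).
Hypothesis sEE : {subset E <= E'}.
Hypothesis sSS : {subset S' <= S}.
Hypothesis c_ge1 : forall e, e \in E' -> 1 <= c e.1 e.2.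

Definition zero_on (P : pred T) m := [forall v in P, m v == 0 :> nat].

Definition hweight (F : pred (T * T)) (P : pred T) m : R :=
  (zero_on P m)%:R *
  \sum_s \prod_(e | e \in F) hedge (c e.1 e.2) (height m s e.1) (height m s e.2).

Hypothesis bdES : forall e, e \in E' -> e \notin E -> (e.1 \in S) && (e.2 \in S).

Definition freeze m s : R := \prod_(e | (e \in E') && frozen m e) agree e s.

(** An edge of [E'] outside [F] has both ends in [P], where [m] = 0: its gradient factor is 1 and it
    is not frozen. Thus the gradient and freezing factors can be taken over [E'] in both models, and
    only the Ising factor depends on [F]. *)
Lemma hweight_factor (F : pred (T * T)) (P : pred T) m : {subset F <= E'} ->
  (forall e, e \in E' -> e \notin F -> (e.1 \in P) && (e.2 \in P)) ->
  hweight F P m = (zero_on P m)%:R * \prod_(e | e \in E') grad (c e.1 e.2) (m e.1) (m e.2) *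
    \sum_s (\prod_(e | e \in F) ising e s) * freeze m s.
Proof.
move=> sF bF; rewrite /hweight; case: (boolP (zero_on P m)); last by rewrite !mul0r.
move=> /forallP z; rewrite !mul1r mulr_sumr; apply: eq_bigr => s _.
have z0 v : v \in P -> (m v = 0 :> nat)%N by move=> vP; have := z v; rewrite vP => /eqP.
have -> : freeze m s = \prod_(e | (e \in F) && frozen m e) agree e s.
  rewrite /freeze; apply: eq_bigl => e.
  case: (boolP (e \in F)) => eF; first by rewrite sF.
  case: (boolP (e \in E')) => //= eE.
  have /andP[/z0 h1 /z0 h2] := bF _ eE eF.
  by rewrite /frozen h1 h2.
have -> : \prod_(e | e \in E') grad (c e.1 e.2) (m e.1) (m e.2) =
   \prod_(e | e \in F) grad (c e.1 e.2) (m e.1) (m e.2).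
  rewrite [LHS](bigID (mem F)) /= [X in _ * X]big1 ?mulr1.
    apply: eq_bigl => e; case: (boolP (e \in F)) => eF; first by rewrite sF.
    by rewrite andbF.
  move=> e /andP[eE eF]; have /andP[/z0 h1 /z0 h2] := bF _ eE eF.
  by rewrite /grad h1 h2 eqxx.
rewrite big_mkcondr -!big_split /=; apply: eq_bigr => e eF.
rewrite hedge_factor -?mulrA //.
by apply: lt_le_trans ltr01 (c_ge1 (sF _ eF)).
Qed.

Lemma agree_ge0 e s : 0 <= agree e s.
Proof. by rewrite /agree; case: ifP. Qed.

Lemma agree_le1 e s : agree e s <= 1.
Proof. by rewrite /agree; case: ifP. Qed.

Lemma ising_ge0 e s : e \in E' -> 0 <= ising e s.
Proof. by move=> /c_ge1 h; rewrite /ising; case: ifP => _; lra. Qed.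

(** Griffiths' inequality for the common weight [w] (Ising on [E], edges frozen by both [m] and
    [n]), with [f] the edges frozen by [m] only and [g] the extra Ising edges together with those
    frozen by [n] only. An edge is frozen by the maximum iff it is frozen by [m] or [n], so
    [w * (f * g)] is the weight for [cmax m n]. *)
Lemma ising_lattice m n :
  (\sum_s (\prod_(e | e \in E) ising e s) * freeze m s) *
  (\sum_s (\prod_(e | e \in E') ising e s) * freeze n s) <=
  (\sum_s (\prod_(e | e \in E') ising e s) * freeze (cmax m n) s) *
  (\sum_s (\prod_(e | e \in E) ising e s) * freeze (cmin m n) s).
Proof.
pose w s := (\prod_(e | e \in E) ising e s) *
   \prod_(e | (e \in E') && (frozen m e && frozen n e)) agree e s.
pose f s := \prod_(e | (e \in E') && (frozen m e && ~~ frozen n e)) agree e s.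
pose g s := (\prod_(e | (e \in E') && (e \notin E)) ising e s) *
   \prod_(e | (e \in E') && (~~ frozen m e && frozen n e)) agree e s.
have splitE s : \prod_(e | e \in E') ising e s =
    (\prod_(e | e \in E) ising e s) * \prod_(e | (e \in E') && (e \notin E)) ising e s.
  rewrite (bigID (mem E)) /=; congr (_ * _); apply: eq_bigl => e.
  by case: (boolP (e \in E)) => eE; rewrite ?andbF // sEE.
have -> : \sum_s (\prod_(e | e \in E) ising e s) * freeze m s = \sum_s w s * f s.
  apply: eq_bigr => s _; rewrite /w /f -mulrA; congr (_ * _).
  rewrite /freeze (bigID (frozen n)) /=; congr (_ * _); apply: eq_bigl => e.
    by rewrite andbA.
  by rewrite andbA.
have -> : \sum_s (\prod_(e | e \in E') ising e s) * freeze n s = \sum_s w s * g s.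
  apply: eq_bigr => s _; rewrite splitE /w /g.
  rewrite /freeze [RHS]mulrACA; congr (_ * _); rewrite (bigID (frozen m)) /=; congr (_ * _).
    by apply: eq_bigl => e; rewrite -andbA [frozen n e && _]andbC.
  by apply: eq_bigl => e; rewrite -andbA [frozen n e && _]andbC.
have fcmax e : frozen (cmax m n) e = frozen m e || frozen n e.
  rewrite /frozen !ffunE /omax.
  by case: (leqP (m e.1) (n e.1)) => h1; case: (leqP (m e.2) (n e.2)) => h2; lia.
have -> : \sum_s (\prod_(e | e \in E') ising e s) * freeze (cmax m n) s =
    \sum_s w s * (f s * g s).
  apply: eq_bigr => s _.
  have -> : freeze (cmax m n) s =
      (\prod_(e | (e \in E') && (frozen m e && frozen n e)) agree e s) *
      f s * \prod_(e | (e \in E') && (~~ frozen m e && frozen n e)) agree e s.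
    rewrite /freeze (bigID (frozen m)) /= (bigID (frozen n)) /=.
    congr (_ * _); [congr (_ * _)|]; apply: eq_bigl => e; rewrite fcmax;
      by case: (frozen m e); case: (frozen n e); rewrite ?andbF ?andbT.
  have AC (x1 x2 x3 x4 x5 : R) : x1 * x2 * (x3 * x4 * x5) = x1 * x3 * (x4 * (x2 * x5)).
    by ring.
  by rewrite splitE AC.
have Cf : cone f.
  by apply: cone_prod => e _; apply: cone_edge; rewrite ?ler01.
have Cg : cone g.
  apply: cone_mul; apply: cone_prod => e; last by move=> _; apply: cone_edge; rewrite ?ler01.
  by case/andP=> /c_ge1 h _; apply: cone_edge; rewrite ?ler01.
have Cw : dup_cone w.
  apply: dup_cone_mul; apply: dup_cone_prod => e; last by move=> _; apply: dup_cone_edge; rewrite ?ler01.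
  by move=> /sEE/c_ge1 h; apply: dup_cone_edge; rewrite ?ler01.
apply: le_trans (griffiths Cw Cf Cg) _; rewrite mulrC; apply: ler_wpM2l.
  apply: sumr_ge0 => s _; apply: mulr_ge0; [apply: mulr_ge0|apply: mulr_ge0; last apply: mulr_ge0];
    apply: prodr_ge0 => e; rewrite ?agree_ge0 //.
    by move=> /sEE; exact: ising_ge0.
  by case/andP=> eE _; exact: ising_ge0.
apply: ler_sum => s _; apply: ler_wpM2l.
  by apply: prodr_ge0 => e /sEE; exact: ising_ge0.
(* It remains to bound [w] by the weight for [cmin m n]. An edge frozen by the minimum is frozen by
   both, but not conversely, so [w] may carry additional factors, each at most 1. *)
rewrite /freeze [X in X <= _](bigID (frozen (cmin m n))) /=.
rewrite [X in _ <= X](_ : _ = (\prod_(e | (e \in E') && frozen (cmin m n) e) agree e s) * 1); last by rewrite mulr1.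
have fcmin e : frozen (cmin m n) e -> frozen m e && frozen n e.
  rewrite /frozen !ffunE /omin.
  by case: (leqP (m e.1) (n e.1)) => h1; case: (leqP (m e.2) (n e.2)) => h2; lia.
apply: ler_pM.
- by apply: prodr_ge0 => e _; exact: agree_ge0.
- by apply: prodr_ge0 => e _; exact: agree_ge0.
- rewrite le_eqVlt; apply/orP; left; apply/eqP; apply: eq_bigl => e.
  by case: (boolP (frozen (cmin m n) e)) => [/fcmin ->|]; rewrite ?andbF ?andbT.
- by apply: prodr_ile1 => e; rewrite agree_ge0 agree_le1.
Qed.

Lemma zero_on_lattice m n : zero_on S m -> zero_on S' n ->
  zero_on S' (cmax m n) && zero_on S (cmin m n).
Proof.
move=> /forallP zm /forallP zn; apply/andP; split; apply/forallP => v; apply/implyP => vS.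
  have := zm v; have := zn v; rewrite vS (sSS vS) /= !ffunE /omax => /eqP h1 /eqP h2.
  by case: ifP => _; rewrite ?h1 ?h2.
have := zm v; rewrite vS /= !ffunE /omin => /eqP h1; rewrite h1 leq0n.
by rewrite h1.
Qed.

Lemma hedge_ge0 (a : R) x y : 0 <= a -> 0 <= hedge a x y.
Proof. by rewrite /hedge; do !case: ifP => _. Qed.

Lemma hweight_ge0 (F : pred (T * T)) (P : pred T) m : {subset F <= E'} ->
  0 <= hweight F P m.
Proof.
move=> sF; rewrite mulr_ge0 ?ler0n //; apply: sumr_ge0 => s _; apply: prodr_ge0 => e /sF/c_ge1 h.
by apply: hedge_ge0; lra.
Qed.

Lemma hweight_holley m n :
  hweight E S m * hweight E' S' n <= hweight E' S' (cmax m n) * hweight E S (cmin m n).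
Proof.
have sE' : {subset E' <= E'} by [].
have hE k := hweight_factor k sEE bdES.
have bd' e : e \in E' -> e \notin E' -> (e.1 \in S') && (e.2 \in S') by move=> ->.
have hE' k := hweight_factor k sE' bd'.
case: (boolP (zero_on S m)) => zm; last first.
  by rewrite /hweight (negPf zm) !mul0r mulr_ge0 ?hweight_ge0.
case: (boolP (zero_on S' n)) => zn; last first.
  by rewrite [X in _ * X]/hweight (negPf zn) !mul0r mulr0 mulr_ge0 ?hweight_ge0.
rewrite !hE !hE' zm zn.
have /andP[-> ->] := zero_on_lattice zm zn.
rewrite !mul1r mulrACA [X in _ <= X]mulrACA; apply: ler_pM.
- by apply: mulr_ge0; apply: prodr_ge0 => e eE; apply: grad_ge0; apply: le_trans ler01 (c_ge1 eE).
- apply: mulr_ge0; apply: sumr_ge0 => s _; apply: mulr_ge0; apply: prodr_ge0 => e; rewrite ?agree_ge0 //;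
    by move=> eE; apply: ising_ge0; rewrite ?(sEE eE).
- rewrite -!big_split /=; apply: ler_prod => e eE.
  have h1 := c_ge1 eE.
  rewrite mulr_ge0 ?grad_ge0 /=; try lra.
  by rewrite !ffunE; apply: grad_lattice.
- exact: ising_lattice.
Qed.

Lemma hweight_monotone (phi : conf -> R) : (forall m, 0 <= phi m) ->
  (forall m n, phi m <= phi (cmax m n)) ->
  (\sum_m phi m * hweight E S m) * (\sum_m hweight E' S' m) <=
  (\sum_m phi m * hweight E' S' m) * (\sum_m hweight E S m).
Proof.
move=> phi0 phim; have sE' : {subset E' <= E'} by [].
have w0 m : 0 <= hweight E S m by exact: hweight_ge0.
have w0' m : 0 <= hweight E' S' m by exact: hweight_ge0.
(* The four functions are phi w, w', phi w' and w, with w and w' the weights of the two models. *)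
apply: four_functions => [m|m|m|m|m n].
- exact: mulr_ge0.
- exact: w0'.
- exact: mulr_ge0.
- exact: w0.
rewrite -(mulrA (phi m)) -(mulrA (phi (cmax m n))).
apply: ler_pM (phi0 m) (mulr_ge0 _ _) (phim m n) (hweight_holley m n) => //.
Qed.

End FiniteModel.

(** * Heights on a finite subgraph *)

Lemma fine_esum_finType (R : realType) (I : finType) (J : choiceType) (P : pred I)
    (A : set J) (e : I -> J) (F : J -> R) :
  set_bij [set` P] A e -> (forall h, A h -> 0 <= F h) ->
  fine (\esum_(h in A) (F h)%:E)%E = \sum_(p | P p) F (e p).
Proof.
move=> eb F0; rewrite (reindex_esum _ _ _ _ eb) esum_fset; first last.
- move=> i; rewrite inE /= => Pi; rewrite lee_fin; apply: F0.
  by case: eb => + _ _; apply.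
- exact: finite_finset.
rewrite -(@bigfs _ _ _ _ (index_enum I)) ?index_enum_uniq //.
  by rewrite sumEFin.
by move=> i _; rewrite mem_index_enum.
Qed.

Lemma big_seq_sub (R : Type) (idx : R) (op : Monoid.com_law idx) (V : choiceType)
    (r s : seq V) (Q : pred V) (F : V -> R) : uniq r -> {subset r <= s} ->
  \big[op/idx]_(u <- r | Q u) F u =
  \big[op/idx]_(t : seq_sub s | (val t \in r) && Q (val t)) F (val t).
Proof.
move=> ur rs.
rewrite -(big_map val (fun u => (u \in r) && Q u) F) -big_filter_cond.
apply: perm_big; apply: uniq_perm => //.
  rewrite filter_uniq // map_inj_uniq ?index_enum_uniq //; exact: val_inj.
move=> u; rewrite mem_filter; case: (boolP (u \in r)) => //= ur'.
by symmetry; apply/mapP; exists (SeqSub (rs _ ur')); rewrite ?mem_index_enum.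
Qed.

(** Flips supported on [A] act freely and preserve [F]; each orbit contains exactly one
    configuration vanishing on [A]. *)
Lemma sum_pinned (R : realFieldType) (T : finType) (A : pred T)
    (F : {ffun T -> bool} -> R) :
  (forall t s : {ffun T -> bool}, (forall i, t i -> A i) -> F (flips t s) = F s) ->
  \sum_s F s = #|[pred t : {ffun T -> bool} | [forall i, t i ==> A i]]|%:R *
    \sum_(s : {ffun T -> bool} | [forall i, A i ==> ~~ s i]) F s.
Proof.
move=> Finv.
rewrite (partition_big (fun s : {ffun T -> bool} => [ffun i => A i && s i])
  (fun t => [forall i, t i ==> A i])) /=; last first.
  by move=> s _; apply/forallP => i; rewrite ffunE; apply/implyP => /andP[].
rewrite -sumr_const mulr_suml big_mkcond [RHS]big_mkcond; apply: eq_bigr => t _.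
rewrite inE; case: forallP => // tA; rewrite mul1r.
rewrite (reindex_inj (inv_inj (flipsK t))).
apply: eq_big => [s|s _]; last by apply: Finv => i; apply/implyP.
apply/eqP/forallP => [/ffunP H i|H].
  have := H i; have := tA i; rewrite !ffunE.
  by case: (A i); case: (s i); case: (t i).
apply/ffunP => i; have := H i; have := tA i; rewrite !ffunE.
by case: (A i); case: (s i); case: (t i).
Qed.

(** * Encoding the heights on D by magnitudes and signs *)

Section Link.
Variables (V : countType) (adj : rel V) (R : realType) (c : V -> V -> R).
Hypothesis Hirr : forall v, ~~ adj v v.
Hypothesis Hc1 : forall u v, adj u v -> 1 <= c u v.
Variables (D D' : fsubgraph V).
Hypothesis HD : is_fin_conn_subgraph adj D.
Hypothesis sDD : {subset fsv D <= fsv D'}.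
Variable k : nat.
Hypothesis bound : forall h v, heights adj D h -> v \in fsv D -> (`|h v| <= k.*2.+1)%N.

(** The model on D lives on the vertices of the larger D', so that both models share one
    configuration space. Magnitudes are truncated at [k], a bound valid for all heights on D. *)
Local Notation T := (seq_sub (fsv D')).
Local Notation conf := {ffun T -> 'I_k.+1}.
Local Notation spins := {ffun T -> bool}.

Definition edgesT : pred (T * T) := fun e =>
  fse D (val e.1) (val e.2) && (pickle (val e.1) < pickle (val e.2))%N.

Definition bdryT : pred T := fun t => (val t \notin fsv D) || `[< bdry adj D (val t) >].

Lemma in_edgesT e : (e \in edgesT) =
  fse D (val e.1) (val e.2) && (pickle (val e.1) < pickle (val e.2))%N.
Proof. by []. Qed.

Lemma in_bdryT t : (t \in bdryT) = (val t \notin fsv D) || `[< bdry adj D (val t) >].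
Proof. by []. Qed.

Definition cT (u v : T) : R := c (val u) (val v).

Definition hfun (p : conf * spins) (v : V) : int :=
  if v \in fsv D then (if insub v is Some t then height p.1 p.2 t else 0) else 0.

(** Spins outside D do not affect the height; fixing them makes the encoding injective. *)
Definition pinned (s : spins) := [forall t, (val t \notin fsv D) ==> ~~ s t].

Definition confP (p : conf * spins) :=
  [&& [forall t, (val t \notin fsv D) ==> (p.1 t == 0 :> nat)], pinned p.2 &
    `[< heights adj D (hfun p) >]].

Lemma hfun_val p (t : T) : val t \in fsv D -> hfun p (val t) = height p.1 p.2 t.
Proof. by move=> tD; rewrite /hfun tD valK. Qed.

Lemma edge_mem u v : fse D u v -> [/\ adj u v, u \in fsv D & v \in fsv D].
Proof. by case: HD => _ + _; apply. Qed.

Lemma height_inj (m m' : conf) (s s' : spins) t :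
  height m s t = height m' s' t -> m t = m' t /\ s t = s' t.
Proof.
rewrite /height; move: (m t) (m' t) => i j.
have ij : (i = j :> nat) -> i = j by exact: val_inj.
by case: (s t); case: (s' t) => /=; rewrite ?expr1 ?expr0 => H; (split; [apply: ij; lia|]) => //; exfalso; lia.
Qed.

Lemma hfun_bij : set_bij [set` confP] (heights adj D) hfun.
Proof.
split.
- by move=> p /= /and3P[_ _ /asboolP].
- move=> [m s] [m' s']; rewrite !inE /= => /and3P[/forallP z /forallP q _] /and3P[/forallP z' /forallP q' _] E.
  have H t : m t = m' t /\ s t = s' t.
    have [tD|tD] := boolP (val t \in fsv D).
      by apply: height_inj; have := congr1 (fun f => f (val t)) E; rewrite !hfun_val.
    have /implyP/(_ tD)/eqP a1 := z t; have /implyP/(_ tD)/eqP a2 := z' t.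
    have /implyP/(_ tD)/negPf a3 := q t; have /implyP/(_ tD)/negPf a4 := q' t.
    by split; [apply: val_inj; rewrite /= a1 a2|rewrite a3 a4].
  by congr pair; apply/ffunP => t; case: (H t).
- move=> h hD; have [h0 hodd _ _] := hD.
  (* Halving the odd number |h| = 2 m + 1 recovers [m]. Off D, h = 0 gives [m] = 0 and a false spin,
     as [confP] demands. *)
  pose m : conf := [ffun t => inord (`|h (val t)|%N./2)].
  pose s : spins := [ffun t : T => h (val t) < 0].
  have hE : hfun (m, s) = h.
    apply/funext => v; have [vD|vD] := boolP (v \in fsv D); last first.
      by rewrite /hfun (negPf vD) h0.
    rewrite -[v]/(val (SeqSub (sDD vD))) hfun_val //=.
    rewrite /height !ffunE /= inordK; last by have := bound hD vD; lia.
    have [j ->] := hodd _ vD.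
    by case: ltP => h1; rewrite ?expr1 ?expr0; lia.
  exists (m, s) => //=; apply/and3P; split; last by apply/asboolP; rewrite hE.
    by apply/forallP => t; apply/implyP => /h0 tD; rewrite ffunE tD /= inordK.
  by apply/forallP => t; apply/implyP => /h0 tD; rewrite ffunE tD.
Qed.

Lemma weight_edgesT h : weight c D h =
  \prod_(e | e \in edgesT) (if h (val e.1) == h (val e.2) then cT e.1 e.2 else 1).
Proof.
have us : {subset undup (fsv D) <= fsv D'} by move=> v; rewrite mem_undup; apply: sDD.
rewrite /weight (big_seq_sub _ _ _ (undup_uniq _) us).
under [LHS]eq_bigr => t _ do rewrite (big_seq_sub _ _ _ (undup_uniq _) us).
rewrite pair_big_dep; apply: eq_bigl => -[u v] /=; rewrite !mem_undup andbT [RHS]unfold_in /=.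
have [/edge_mem [_ /= -> ->]//|_] := boolP (fse D (ssval u) (ssval v)).
by rewrite !andbF.
Qed.

Lemma heights_hfun m s : zero_on bdryT m ->
  (forall e, e \in edgesT -> `|height m s e.1 - height m s e.2| <= 2) ->
  heights adj D (hfun (m, s)).
Proof.
move=> /forallP z g; split.
- by move=> v /negPf vD; rewrite /hfun vD.
- move=> v vD; rewrite -[v]/(val (SeqSub (sDD vD))) hfun_val //= /height.
  case: (s _); rewrite ?expr1 ?expr0; [exists (- (m (SeqSub (sDD vD)))%:Z - 1)|exists (m (SeqSub (sDD vD)))%:Z]; lia.
- move=> u v uv; have [auv uD vD] := edge_mem uv.
  rewrite -[u]/(val (SeqSub (sDD uD))) -[v]/(val (SeqSub (sDD vD))) !hfun_val //=.
  have [lt|gt|E] := ltngtP (pickle u) (pickle v).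
  + by apply: (g (SeqSub (sDD uD), SeqSub (sDD vD))); rewrite unfold_in /= uv.
  + rewrite distrC; apply: (g (SeqSub (sDD vD), SeqSub (sDD uD))); rewrite unfold_in /= gt andbT.
    by case: HD => + _ _; apply.
  + by have := Hirr v; rewrite -{1}(pcan_inj pickleK E) auv.
- move=> v bv; have vD : v \in fsv D by case: bv.
  have := z (SeqSub (sDD vD)); rewrite unfold_in /= vD /= asboolT //= => /eqP m0.
  rewrite -[v]/(val (SeqSub (sDD vD))) hfun_val //= /height m0.
  by case: (s _); rewrite ?expr1 ?expr0; [right|left].
Qed.

(** For a pinned pair that is not admissible, either [m] is nonzero somewhere in [bdryT] or some
    edge has a jump above 2, and a factor on the right vanishes too. Otherwise |h x| = 2 m x + 1 and
    evenness of [G] removes the sign. *)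
Lemma confP_term (G : int -> R) (x : T) (m : conf) (s : spins) : val x \in fsv D ->
  (forall z, G (- z) = G z) ->
  (if confP (m, s) then G (hfun (m, s) (val x)) * weight c D (hfun (m, s)) else 0) =
  (if pinned s then G (m x).*2.+1%:Z * ((zero_on bdryT m)%:R *
     \prod_(e | e \in edgesT) hedge (cT e.1 e.2) (height m s e.1) (height m s e.2)) else 0).
Proof.
move=> xD Geven; rewrite /confP /=.
have [ps|ps] := boolP (pinned s); last by rewrite andbF.
have [z|z] /= := boolP (zero_on bdryT m); last first.
  rewrite mul0r mulr0; case: ifP => // /andP[/forallP z0 /asboolP[_ _ _ hb]].
  move/negP: z; case; apply/forallP => t; apply/implyP; rewrite unfold_in.
  have [tD|tD] := boolP (val t \in fsv D); last by move=> _; apply: (implyP (z0 t)).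
  move=> /= /asboolP /hb; rewrite hfun_val //= /height.
  move: (nat_of_ord (m t)) => i.
  by case: (s t) => /=; rewrite ?expr1 ?expr0 => -[] H; apply/eqP; lia.
have z0 : [forall t, (val t \notin fsv D) ==> (m t == 0 :> nat)].
  apply/forallP => t; apply/implyP => tD; have /forallP/(_ t)/implyP := z; apply.
  by rewrite unfold_in tD.
rewrite z0 /= mul1r.
have [g|g] := pselect (forall e, e \in edgesT -> `|height m s e.1 - height m s e.2| <= 2).
  rewrite asboolT; last exact: heights_hfun.
  congr (_ * _).
    rewrite hfun_val //= /height.
    by case: (s x); rewrite ?expr1 ?expr0 ?mulN1r ?mul1r ?Geven.
  rewrite weight_edgesT; apply: eq_bigr => e eE; rewrite /hedge g //.
  by move: eE; rewrite unfold_in => /andP[/edge_mem[_ h1 h2] _]; rewrite !hfun_val.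
rewrite asboolF; last first.
  move=> [_ _ hg _]; apply: g => e; rewrite unfold_in => /andP[eD _].
  by have := hg _ _ eD; have [_ h1 h2] := edge_mem eD; rewrite !hfun_val.
move/existsNP: g => [e /not_implyP[eE /negP ge]].
by rewrite (bigD1 e) //= /hedge (negPf ge) mul0r mulr0.
Qed.

Lemma weight_ge0 h : 0 <= weight c D h.
Proof.
apply: prodr_ge0 => u _; apply: prodr_ge0 => v /andP[/edge_mem[/Hc1 h1 _ _] _].
by case: ifP => _; lra.
Qed.

Definition npin := #|[pred t : spins | [forall i, t i ==> (val i \notin fsv D)]]|.

Lemma npin_gt0 : (0 < npin)%N.
Proof.
apply/card_gt0P; exists [ffun => false]; rewrite inE; apply/forallP => i.
by rewrite ffunE.
Qed.

(** [hweight] also sums over the free spins outside D, hence the multiplicity [npin], which cancels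
    in [Esq]. A general [G] covers both the second moment and, with [G] = 1, the normalisation. *)
Lemma esum_heights (G : int -> R) (x : T) : val x \in fsv D ->
  (forall z, G (- z) = G z) -> (forall z, 0 <= G z) ->
  npin%:R * fine (\esum_(h in heights adj D) (G (h (val x)) * weight c D h)%:E)%E =
  \sum_(m : conf) G (m x).*2.+1%:Z * hweight cT edgesT bdryT m.
Proof.
move=> xD Geven G0.
rewrite (fine_esum_finType hfun_bij); last by move=> h _; rewrite mulr_ge0 ?weight_ge0.
pose A (m : conf) (s : spins) := if pinned s then G (m x).*2.+1%:Z * ((zero_on bdryT m)%:R *
  \prod_(e | e \in edgesT) hedge (cT e.1 e.2) (height m s e.1) (height m s e.2)) else 0.
have -> : \sum_(p | confP p) G (hfun p (val x)) * weight c D (hfun p) =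
    \sum_(m : conf) \sum_(s : spins) A m s.
  by rewrite pair_big big_mkcond; apply: eq_bigr => -[m s] _; exact: confP_term.
rewrite mulr_sumr; apply: eq_bigr => m _.
rewrite -big_mkcond /= -!mulr_sumr /hweight mulrCA [_%:R * (_ * _)]mulrCA.
congr (_ * (_ * _)); symmetry; apply: (sum_pinned (A := fun t => val t \notin fsv D)) => t s tA.
apply: eq_bigr => e; rewrite unfold_in => /andP[/edge_mem[_ h1 h2] _].
have fl (w : T) : val w \in fsv D -> height m (flips t s) w = height m s w.
  move=> wD; rewrite /height ffunE; case E: (t w); last by rewrite addbF.
  by have := tA _ E; rewrite wD.
by rewrite !fl.
Qed.

End Link.

(** The constant height 1 contributes the product of all c_e. This makes the partition functions
    positive. *)
Lemma hweight_zero_gt0 (R : realFieldType) (T : finType) (k : nat) (c : T -> T -> R)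
    (E : pred (T * T)) (S : pred T) :
  (forall e, e \in E -> 1 <= c e.1 e.2) ->
  0 < hweight c E S ([ffun => ord0] : {ffun T -> 'I_k.+1}).
Proof.
move=> c1; rewrite /hweight.
have -> : zero_on S ([ffun => ord0] : {ffun T -> 'I_k.+1}).
  by apply/forallP => v; rewrite ffunE implybT.
rewrite mul1r (bigD1 [ffun => false]) //= ltr_wpDr //.
  apply: sumr_ge0 => s _; apply: prodr_ge0 => e /c1 h; apply: hedge_ge0; lra.
apply: prodr_gt0 => e /c1 h.
by rewrite /hedge /height !ffunE subrr eqxx normr0 /=; lra.
Qed.

Lemma exists_uniform (A : eqType) (P : nat -> A -> Prop) (s : seq A) :
  (forall i j a, (i <= j)%N -> P i a -> P j a) ->
  (forall a, a \in s -> exists n, P n a) ->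
  exists n, forall a, a \in s -> P n a.
Proof.
move=> mono; elim: s => [|a s IH] H; first by exists 0%N.
have [n Hn] : exists n, forall b, b \in s -> P n b.
  by apply: IH => b bs; apply: H; rewrite inE bs orbT.
have [i Hi] := H a (mem_head _ _).
exists (maxn n i) => b; rewrite inE => /orP[/eqP ->|/Hn Hb].
  exact: mono (leq_maxr _ _) Hi.
exact: mono (leq_maxl _ _) Hb.
Qed.

(** * The infinite graph: comparison of domains and change of vertex *)

Section Graph.
Variables (V : countType) (adj : rel V) (R : realType) (c : V -> V -> R).
Hypothesis Hinf : ~ exists s : seq V, forall v, v \in s.
Hypothesis Hsym : forall u v, adj u v -> adj v u.
Hypothesis Hirr : forall v, ~~ adj v v.
Hypothesis Hconn : forall u v, exists p : seq V, path adj u p /\ last u p = v.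
Hypothesis Hc1 : forall u v, adj u v -> 1 <= c u v.
Implicit Types D : fsubgraph V.

(** The graph is infinite, so some vertex lies outside D; a path towards it from [x] leaves D for
    the first time through a boundary vertex. *)
Lemma bdry_exists D x : is_fin_conn_subgraph adj D -> x \in fsv D ->
  exists b, bdry adj D b.
Proof.
move=> [_ eD _] xD.
have [w wD] : exists w, w \notin fsv D.
  apply: contrapT => H; apply: Hinf; exists (fsv D) => v.
  by apply: contrapT => vD; apply: H; exists v; apply/negP.
have [p [pp lp]] := Hconn x w; rewrite -{}lp in wD.
elim: p x xD pp wD => [|y p IH] x xD /=; first by rewrite xD.
move=> /andP[xy pp] wD; have [yD|yD] := boolP (y \in fsv D); first exact: IH yD pp wD.
exists x; split=> //; exists y; split=> //; apply/negP => /eD[_ _ yD'].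
by rewrite yD' in yD.
Qed.

Lemma height_path D h u p : heights adj D h -> path (fse D) u p ->
  `|h u - h (last u p)| <= (size p).*2%:Z.
Proof.
move=> [_ _ hg _]; elim: p u => [|v p IH] u /=; first by rewrite subrr normr0.
by move=> /andP[/hg h1 /IH h2]; lia.
Qed.

(** Each vertex is joined inside D to a boundary vertex, where |h| = 1, and h changes by at most 2
    per edge. Hence only finitely many magnitudes occur. *)
Lemma height_bound D x : is_fin_conn_subgraph adj D -> x \in fsv D ->
  exists k, forall h v, heights adj D h -> v \in fsv D -> (`|h v| <= k.*2.+1)%N.
Proof.
move=> cD xD; have [b bD] := bdry_exists cD xD.
have [_ _ conD] := cD.
pose P (k : nat) v := forall h, heights adj D h -> (`|h v| <= k.*2.+1)%N.
have [k Hk] : exists k, forall v, v \in fsv D -> P k v.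
  apply: exists_uniform => [i j v ij H h /H hv|v vD].
    by apply: leq_trans hv _; lia.
  have [p [pp lp]] := conD v b vD bD.1.
  exists (size p) => h hh; have := height_path hh pp; rewrite lp.
  by have [_ _ _ /(_ _ bD) [->|->]] := hh; lia.
by exists k => h v hh vD; apply: Hk.
Qed.

Lemma Esq_hweight D D' (k : nat) (x : seq_sub (fsv D')) :
  is_fin_conn_subgraph adj D -> {subset fsv D <= fsv D'} -> val x \in fsv D ->
  (forall h v, heights adj D h -> v \in fsv D -> (`|h v| <= k.*2.+1)%N) ->
  Esq adj c D (val x) =
  (\sum_(m : {ffun _ -> 'I_k.+1}) ((m x).*2.+1%:Z)%:~R ^+ 2 *
     hweight (cT c (D' := D')) (edgesT D (D' := D')) (bdryT adj D (D' := D')) m) /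
  (\sum_(m : {ffun _ -> 'I_k.+1})
     hweight (cT c (D' := D')) (edgesT D (D' := D')) (bdryT adj D (D' := D')) m).
Proof.
move=> cD sDD xD bd; rewrite /Esq.
have sq0 (z : int) : 0 <= z%:~R ^+ 2 :> R by rewrite sqr_ge0.
have sqN (z : int) : (- z)%:~R ^+ 2 = z%:~R ^+ 2 :> R by rewrite rmorphN sqrrN.
rewrite -(esum_heights Hirr Hc1 cD sDD bd (G := fun z => z%:~R ^+ 2) xD sqN sq0).
have -> : \sum_(m : {ffun _ -> 'I_k.+1})
     hweight (cT c (D' := D')) (edgesT D (D' := D')) (bdryT adj D (D' := D')) m =
   (npin D D')%:R * fine (\esum_(h in heights adj D) (weight c D h)%:E)%E.
  have := esum_heights Hirr Hc1 cD sDD bd (G := fun=> 1) xD (fun=> erefl) (fun=> ler01).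
  under [X in fine X]eq_esum do rewrite mul1r.
  by move=> ->; apply: eq_bigr => m _; rewrite mul1r.
by rewrite -mulf_div divff ?mul1r // pnatr_eq0 -lt0n npin_gt0.
Qed.

Lemma edgesT_ge1 D D' : is_fin_conn_subgraph adj D ->
  forall e, e \in edgesT D (D' := D') -> 1 <= cT c e.1 e.2.
Proof.
by move=> [_ eD _] e; rewrite unfold_in => /andP[/eD[/Hc1]].
Qed.

Lemma Esq_le D D' x : is_fin_conn_subgraph adj D -> is_fin_conn_subgraph adj D' ->
  subgraph_of D D' -> x \in fsv D -> Esq adj c D x <= Esq adj c D' x.
Proof.
move=> cD cD' [sV sE] xD.
have [k0 b0] := height_bound cD xD.
have [k1 b1] := height_bound cD' (sV _ xD).
pose k := maxn k0 k1.
have bD h v : heights adj D h -> v \in fsv D -> (`|h v| <= k.*2.+1)%N.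
  by move=> hh vD; apply: leq_trans (b0 _ _ hh vD) _; rewrite /k; lia.
have bD' h v : heights adj D' h -> v \in fsv D' -> (`|h v| <= k.*2.+1)%N.
  by move=> hh vD; apply: leq_trans (b1 _ _ hh vD) _; rewrite /k; lia.
pose t : seq_sub (fsv D') := SeqSub (sV _ xD).
rewrite -[x]/(val t) (Esq_hweight (x := t) cD sV xD bD).
have sVV : {subset fsv D' <= fsv D'} by [].
rewrite (Esq_hweight (x := t) cD' sVV (sV _ xD) bD').
have Z0 D0 : is_fin_conn_subgraph adj D0 -> 0 < \sum_(m : {ffun _ -> 'I_k.+1})
     hweight (cT c (D' := D')) (edgesT D0 (D' := D')) (bdryT adj D0 (D' := D')) m.
  move=> cD0; have c1 := edgesT_ge1 cD0 (D' := D').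
  rewrite (bigD1 [ffun => ord0]) //= ltr_wpDr ?hweight_zero_gt0 //.
  by apply: sumr_ge0 => m _; apply: (hweight_ge0 c1).
have [_ eD _] := cD; have [_ eD' _] := cD'.
rewrite ler_pdivrMr ?Z0 // mulrAC ler_pdivlMr ?Z0 //.
apply: (hweight_monotone (E := edgesT D (D' := D')) (S := bdryT adj D (D' := D'))).
- by move=> e; rewrite !in_edgesT => /andP[/sE -> ->].
(* An edge missing from D' is also missing from D, so a boundary vertex of D' that lies in D is on
   the boundary of D. *)
- move=> v; rewrite !in_bdryT; case: (boolP (val v \in fsv D)) => //= vD.
  rewrite (valP v) /= => /asboolP[_ [w [vw nw]]]; apply/asboolP; split=> //.
  by exists w; split=> //; apply: contra nw; exact: sE.
- exact: edgesT_ge1.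
(* Each end of an edge of D' that is not in D lies outside D or on its boundary, as that very edge
   shows. *)
- move=> [u v]; rewrite !in_edgesT !in_bdryT /= => /andP[uv lt]; rewrite lt andbT => nuv.
  have [auv _ _] := eD' _ _ uv.
  apply/andP; split.
    case: (boolP (ssval u \in fsv D)) => //= uD; apply/asboolP; split=> //.
    by exists (ssval v).
  case: (boolP (ssval v \in fsv D)) => //= vD; apply/asboolP; split=> //.
  exists (ssval u); split; first exact: Hsym.
  by apply: contra nuv; case: cD => + _ _; apply.
- by move=> m; exact: sqr_ge0.
- move=> m n; rewrite -!pmulrn ler_sqr ?nnegrE ?ler0n // ler_nat ltnS leq_double.
  by rewrite ffunE /omax; case: ifP.
Qed.

Lemma Esq_path D x p : is_fin_conn_subgraph adj D -> x \in fsv D ->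
  last x p \in fsv D -> path (fse D) x p ->
  Esq adj c D (last x p) <= 2 * Esq adj c D x + 8 * (size p)%:R ^+ 2.
Proof.
move=> cD xD yD pp; have [k bD] := height_bound cD xD.
have sVV : {subset fsv D <= fsv D} by [].
have bij := hfun_bij sVV bD.
have w0 := weight_ge0 Hc1 cD.
(* Positivity of the partition function comes from the encoding with D' = D. *)
have Z0 : 0 < \sum_(q | confP adj D q) weight c D (hfun D (D' := D) (k := k) q).
  rewrite -(fine_esum_finType bij (F := weight c D)) //.
  have := esum_heights (x := SeqSub xD) Hirr Hc1 cD sVV bD (G := fun=> 1) xD (fun=> erefl) (fun=> ler01).
  under [X in fine X]eq_esum do rewrite mul1r.
  rewrite -(pmulr_rgt0 _ (_ : 0 < (npin D D)%:R)) ?ltr0n ?npin_gt0 // => ->.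
  rewrite (bigD1 [ffun => ord0]) //= mul1r ltr_wpDr ?hweight_zero_gt0 //; last exact: edgesT_ge1.
  by apply: sumr_ge0 => m _; rewrite mul1r; apply: (hweight_ge0 (edgesT_ge1 cD (D' := D))).
rewrite /Esq !(fine_esum_finType bij) //; try by move=> h _; rewrite mulr_ge0 ?sqr_ge0.
rewrite ler_pdivrMr // mulrDl -[2 * (_ / _) * _]mulrA divfK ?gt_eqF //.
rewrite !mulr_sumr -big_split /=; apply: ler_sum => q /and3P[_ _ /asboolP hq].
rewrite mulrA -mulrDl; apply: ler_wpM2r => //.
have := height_path hq pp; move: (hfun D q x) (hfun D q (last x p)) => a b hab.
have h1 : (a - b) ^+ 2 <= 4 * (size p)%:Z ^+ 2.
  have -> : 4 * (size p)%:Z ^+ 2 = (size p).*2%:Z ^+ 2.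
    by rewrite -muln2 PoszM exprMn mulrC.
  by rewrite -[X in X <= _]real_normK ?num_real // ler_sqr ?nnegrE.
(* From 2 a^2 + 2 (a - b)^2 - b^2 = (2 a - b)^2 and |a - b| <= 2 [size p]; the bound is pointwise in
   h and is then averaged. *)
have : b ^+ 2 <= 2 * a ^+ 2 + 8 * (size p)%:Z ^+ 2.
  have h2 : 0 <= (2 * a - b) ^+ 2 by exact: sqr_ge0.
  rewrite -subr_ge0 in h1; rewrite -subr_ge0.
  have -> : 2 * a ^+ 2 + 8 * (size p)%:Z ^+ 2 - b ^+ 2 =
      (2 * a - b) ^+ 2 + 2 * (4 * (size p)%:Z ^+ 2 - (a - b) ^+ 2) by ring.
  by rewrite addr_ge0 // mulr_ge0.
rewrite -(ler_int R) !(rmorphD, rmorphM, rmorphXn) /=.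
by [].
Qed.

Lemma path_exhaust (Dn : nat -> fsubgraph V) x p :
  (forall i j, (i <= j)%N -> subgraph_of (Dn i) (Dn j)) ->
  (forall u v, adj u v -> exists n, fse (Dn n) u v) ->
  path adj x p -> exists n, path (fse (Dn n)) x p.
Proof.
move=> mon ex; elim: p x => [|y p IH] x /=; first by exists 0%N.
move=> /andP[/ex[i xy] /IH[j pj]]; exists (maxn i j).
rewrite (mon i _ (leq_maxl _ _)).2 //=.
by apply: sub_path pj => u v; apply: (mon j _ (leq_maxr _ _)).2.
Qed.

End Graph.

Theorem theorem5p1 (V : countType) (adj : rel V) (R : realType) (c : V -> V -> R)
  (Hinf : ~ exists s : seq V, forall v, v \in s)
  (Hsym : forall u v, adj u v -> adj v u)
  (Hirr : forall v, ~~ adj v v)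
  (Hlocfin : forall v, exists s : seq V, forall w, adj v w -> w \in s)
  (Hconn : forall u v, exists p : seq V, path adj u p /\ last u p = v)
  (Hcsym : forall u v, c u v = c v u)
  (Hc1 : forall u v, adj u v -> 1 <= c u v) :
  (forall (x : V) (D D' : fsubgraph V),
      is_fin_conn_subgraph adj D -> is_fin_conn_subgraph adj D' ->
      subgraph_of D D' -> x \in fsv D ->
      Esq adj c D x <= Esq adj c D' x)
  /\
  (exists loc : bool,
     forall (x : V) (Dn : nat -> fsubgraph V),
       (forall n, is_fin_conn_subgraph adj (Dn n)) ->
       (forall n, subgraph_of (Dn n) (Dn n.+1)) ->
       (forall v, exists n, v \in fsv (Dn n)) ->
       (forall u v, adj u v -> exists n, fse (Dn n) u v) ->
       x \in fsv (Dn 0%N) ->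
       (forall n, Esq adj c (Dn n) x <= Esq adj c (Dn n.+1) x) /\
       (if loc then exists l : R, (fun n => Esq adj c (Dn n) x) @ \oo --> l
        else (fun n => Esq adj c (Dn n) x) @ \oo --> +oo)).
Proof.
have mono := Esq_le Hinf Hsym Hirr Hconn Hc1.
split; first by move=> x D D'; exact: mono.
(* The alternative is boundedness at some vertex over all domains containing it, a condition free of
   both [x] and the exhaustion. *)
exists `[< exists y M, forall D, is_fin_conn_subgraph adj D -> y \in fsv D -> Esq adj c D y <= M >].
move=> x Dn cn sn exV exE x0.
have sub i j : (i <= j)%N -> subgraph_of (Dn i) (Dn j).
  move=> /subnK <-; elim: (j - i)%N => [|d [IH1 IH2]]; first by split.
  have [s1 s2] := sn (d + i)%N.
  by split=> [v /IH1/s1|u v /IH2/s2].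
have xn n : x \in fsv (Dn n) by apply: (sub 0%N n (leq0n n)).1.
have nd : nondecreasing_seq (fun n => Esq adj c (Dn n) x).
  by move=> i j ij; apply: mono => //; exact: sub.
split; first by move=> n; apply: nd; exact: leqnSn.
case: asboolP => [[y [M yM]]|nloc].
  have [p [pp lp]] := Hconn y x.
  have [i pi] := path_exhaust sub exE pp.
  have [j yj] := exV y.
  (* From index [N] on, the domains contain [y] and the path to [x]; smaller indices are covered by
     monotonicity. *)
  pose N := maxn i j.
  have bnd n : Esq adj c (Dn n) x <= 2 * M + 8 * (size p)%:R ^+ 2.
    have yN : y \in fsv (Dn (maxn n N)) by apply: (sub j _ _).1 => //; rewrite /N; lia.
    apply: le_trans (nd _ _ (leq_maxl n N)) _.
    have pN : path (fse (Dn (maxn n N))) y p.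
      by apply: sub_path pi => u v; apply: (sub i _ _).2; rewrite /N; lia.
    rewrite -{1}lp; apply: le_trans (Esq_path _ _ _ _ (cn _) yN _ pN) _ => //.
      by rewrite lp.
    by rewrite lerD2r ler_pM2l ?ltr0n // yM.
  exists (sup (range (fun n => Esq adj c (Dn n) x))); apply: nondecreasing_cvgn => //.
  by exists (2 * M + 8 * (size p)%:R ^+ 2) => _ [n _ <-].
apply/cvgryPge => M.
(* Unboundedness, used at [x] itself, gives one domain with second moment at least [M]; being
   finite, it lies inside some member of the exhaustion. *)
have [D [cD xD MD]] : exists D, [/\ is_fin_conn_subgraph adj D, x \in fsv D & M <= Esq adj c D x].
  apply: contrapT => H; apply: nloc; exists x, M => D cD xD.
  by rewrite leNgt; apply/negP => /ltW lt; apply: H; exists D.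
have [i Hi] : exists i, forall v, v \in fsv D -> v \in fsv (Dn i).
  apply: exists_uniform => [i j v ij|v _]; last exact: exV.
  exact: (sub i j ij).1.
have [_ eD _] := cD.
(* The edges of D form a relation, so uniformity is obtained over the finite list of all pairs of
   its vertices; pairs that are not edges impose nothing. *)
have [j Hj] : exists j, forall e, e \in [seq (u, v) | u <- fsv D, v <- fsv D] ->
    fse D e.1 e.2 -> fse (Dn j) e.1 e.2.
  apply: exists_uniform => [a b e ab H /H|[u v] _ /=]; first exact: (sub a b ab).2.
  have [/eD[/exE[n un] _ _]|nuv] := boolP (fse D u v); first by exists n.
  by exists 0%N.
have sDN : subgraph_of D (Dn (maxn i j)).
  split=> [v /Hi|u v uv]; first exact: (sub i _ (leq_maxl _ _)).1.
  have [_ uD vD] := eD _ _ uv.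
  apply: (sub j _ (leq_maxr _ _)).2.
  by apply: (Hj (u, v)) => //; apply/allpairsP; exists (u, v).
exists (maxn i j) => // n /= ijn.
apply: le_trans MD _; apply: le_trans (mono _ _ _ cD (cn _) sDN xD) _.
exact: nd.
Qed.
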